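(* Let $K$ be a field of characteristic $2$, let $m\ge 1$, and let $V$ be a $2m$-dimensional $K$-vector space with a non-degenerate alternating bilinear form $f$. Let $DV$ be the divided power algebra of $V$, regarded as a complex with differential given by multiplication by $\omega=\sum_{i=1}^m x_iy_i\in D_2V$, with cohomology $H^k(DV)$, $k\ge 0$. Then $H^k(DV)=0$ if and only if $k<m$ or $k\not\equiv m \pmod 2$.
   Context: Divided power algebra: $DV=\bigoplus_{k\ge 0}D_kV$ is the commutative graded $K$-algebra generated by divided powers $v^{(a)}\in D_aV$ ($v\in V$, $a\ge 0$), with $v^{(0)}=1$, $v^{(1)}=v$, $v^{(a)}v^{(b)}=\binom{a+b}{a}v^{(a+b)}$, $(tv)^{(a)}=t^av^{(a)}$ for $t\in K$, and $(u+v)^{(a)}=\sum_{i=0}^a u^{(i)}v^{(a-i)}$. If $v_1,\dots,v_n$ is a basis of $V$, then the monomials $v_1^{(a_1)}\cdots v_n^{(a_n)}$ with $a_1+\cdots+a_n=k$ form a basis of $D_kV$. The complex $DV$: fix a basis $x_1,y_1,\dots,x_m,y_m$ of $V$ with $f(x_i,y_j)=\delta_{ij}$ and $f(x_i,x_j)=f(y_i,y_j)=0$. Let $\omega=x_1y_1+\cdots+x_my_m\in D_2V$ and let $\partial_k:D_kV\to D_{k+2}V$ be multiplication by $\omega$. In characteristic $2$ one has $\partial_{k+2}\partial_k=0$. Put $H^k(DV)=\ker\partial_k/\mathrm{Im}\,\partial_{k-2}$ (with $D_jV=0$ for $j<0$). *)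

(* Defs.v *)
From HB Require Import structures.
From mathcomp Require Import all_boot all_order all_algebra.
From mathcomp Require Import finmap.
From mathcomp Require Import monalg.
From mathcomp Require Import boolp.

Set Implicit Arguments.
Unset Strict Implicit.
Unset Printing Implicit Defensive.

Import GRing.Theory.
Local Open Scope ring_scope.
Local Open Scope quotient_scope.

(* [ring_quotient] only provides additive and ring structures on quotients;
   this supplies the scalar multiplication. *)
Section QuotientScale.
Variables (K : fieldType) (M : lmodType K) (S : zmodClosed M).
Hypothesis SZ : GRing.scaler_closed S.

Definition quot_scale (c : K) (u : {ideal_quot S}) : {ideal_quot S} :=
  \pi_({ideal_quot S}) (c *: repr u).

Lemma quot_scale_pi c v :
  quot_scale c (\pi_({ideal_quot S}) v) = \pi_({ideal_quot S}) (c *: v).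
Proof.
apply/eqP; rewrite /quot_scale -Quotient.idealrBE -scalerBr SZ //.
by rewrite Quotient.idealrBE reprK.
Qed.

Lemma quot_scaleA a b u : quot_scale a (quot_scale b u) = quot_scale (a * b) u.
Proof.
elim/quotW: u => v.
by rewrite (quot_scale_pi b) (quot_scale_pi a) (quot_scale_pi (a * b)) scalerA.
Qed.

Lemma quot_scale1 : left_id 1 quot_scale.
Proof. by elim/quotW=> v; rewrite quot_scale_pi scale1r. Qed.

Lemma quot_scaleDr : right_distributive quot_scale +%R.
Proof.
move=> c; elim/quotW=> u; elim/quotW=> v.
by rewrite -raddfD !quot_scale_pi scalerDr raddfD.
Qed.

Lemma quot_scaleDl u : {morph quot_scale^~ u : a b / a + b}.
Proof.
elim/quotW: u => v a b.
by rewrite !quot_scale_pi scalerDl raddfD.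
Qed.

End QuotientScale.

Section QuotientAlgebra.
Variables (K : fieldType) (A : comAlgType K) (I : idealr A).

Lemma ideal_scaler_closed : GRing.scaler_closed I.
Proof. by move=> c p pI; rewrite -mulr_algl idealMr. Qed.

Definition quot_alg : Type := {ideal_quot I}.
HB.instance Definition _ := GRing.ComNzRing.on quot_alg.
HB.instance Definition _ := GRing.Zmodule_isLmodule.Build K quot_alg
  (quot_scaleA ideal_scaler_closed) (quot_scale1 ideal_scaler_closed)
  (quot_scaleDr ideal_scaler_closed) (quot_scaleDl ideal_scaler_closed).

Definition quot_proj (p : A) : quot_alg := \pi_({ideal_quot I}) p.
HB.instance Definition _ := GRing.RMorphism.copy quot_proj
  (\pi_({ideal_quot I}) : A -> {ideal_quot I}).

Lemma quot_proj_is_scalable : scalable quot_proj.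
Proof.
by move=> c p; rewrite /quot_proj -(quot_scale_pi ideal_scaler_closed).
Qed.
HB.instance Definition _ :=
  GRing.isScalable.Build K A quot_alg *:%R quot_proj quot_proj_is_scalable.

Lemma quot_proj_surj u : exists p, u = quot_proj p.
Proof. by exists (repr u); rewrite /quot_proj reprK. Qed.

Lemma quot_proj_eq0 p : (quot_proj p == 0) = (p \in I).
Proof.
by rewrite -(rmorph0 quot_proj) /quot_proj -Quotient.idealrBE subr0.
Qed.

Lemma quot_scaleAl (c : K) (u v : quot_alg) : c *: (u * v) = c *: u * v.
Proof.
have [p ->] := quot_proj_surj u; have [q ->] := quot_proj_surj v.
by rewrite -rmorphM -!linearZ /= -rmorphM -scalerAl.
Qed.
HB.instance Definition _ :=
  GRing.Lmodule_isLalgebra.Build K quot_alg quot_scaleAl.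
HB.instance Definition _ := GRing.Lalgebra_isComAlgebra.Build K quot_alg.

End QuotientAlgebra.

Section GeneratedIdeal.
Variables (R : comNzRingType) (rel : R -> Prop).

Definition gen_ideal : {pred R} := fun p =>
  `[< exists s : seq (R * R)%type,
      (forall q, q \in s -> rel q.2) /\ p = \sum_(q <- s) q.1 * q.2 >].

Lemma gen_idealP p : reflect
  (exists s : seq (R * R)%type,
      (forall q, q \in s -> rel q.2) /\ p = \sum_(q <- s) q.1 * q.2)
  (p \in gen_ideal).
Proof. exact: asboolP. Qed.

Lemma gen_ideal_rel p : rel p -> p \in gen_ideal.
Proof.
move=> rp; apply/gen_idealP; exists [:: (1, p)]; split=> [q|].
  by rewrite inE => /eqP->.
by rewrite big_seq1 mul1r.
Qed.

Lemma gen_ideal_kernel (S : nzRingType) (h : {rmorphism R -> S}) :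
  (forall p, rel p -> h p = 0) -> {in gen_ideal, forall p, h p = 0}.
Proof.
move=> h0 p /gen_idealP[s [rs ->]]; rewrite rmorph_sum big_seq big1 // => q qs.
by rewrite rmorphM /= (h0 q.2) ?mulr0 //; apply: rs.
Qed.

Lemma gen_ideal_closed : 1 \notin gen_ideal -> idealr_closed gen_ideal.
Proof.
move=> n1; split=> //; first by apply/gen_idealP; exists [::]; rewrite big_nil.
move=> a _ _ /gen_idealP[s [rs ->]] /gen_idealP[t [rt ->]]; apply/gen_idealP.
exists ([seq (a * q.1, q.2) | q <- s] ++ t); split=> [q|].
  by rewrite mem_cat => /orP[/mapP[r /rs + ->]|/rt].
rewrite big_cat big_map mulr_sumr; congr (_ + _).
by apply: eq_bigr => q _; rewrite mulrA.
Qed.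

End GeneratedIdeal.

Section Span.
Variables (K : fieldType) (M : lmodType K) (P : M -> Prop).

Definition lspan : {pred M} := fun u =>
  `[< exists s : seq (K * M)%type,
      (forall t, t \in s -> P t.2) /\ u = \sum_(t <- s) t.1 *: t.2 >].

Lemma lspanP u : reflect
  (exists s : seq (K * M)%type,
      (forall t, t \in s -> P t.2) /\ u = \sum_(t <- s) t.1 *: t.2)
  (u \in lspan).
Proof. exact: asboolP. Qed.

Lemma lspan_gen u : P u -> u \in lspan.
Proof.
move=> Pu; apply/lspanP; exists [:: (1, u)]; split=> [t|].
  by rewrite inE => /eqP->.
by rewrite big_seq1 scale1r.
Qed.

Lemma lspan_closed : submod_closed lspan.
Proof.
split; first by apply/lspanP; exists [::]; rewrite big_nil.
move=> c _ _ /lspanP[s [Ps ->]] /lspanP[t [Pt ->]].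
apply/lspanP; exists ([seq (c * q.1, q.2) | q <- s] ++ t); split=> [q|].
  by rewrite mem_cat => /orP[/mapP[r /Ps + ->]|/Pt].
rewrite big_cat big_map scaler_sumr; congr (_ + _).
by apply: eq_bigr => q _; rewrite scalerA.
Qed.
HB.instance Definition _ :=
  GRing.isSubmodClosed.Build K M lspan (GRing.submod_closed_semi lspan_closed).

End Span.

Lemma lspanM (K : fieldType) (A : algType K) (P Q R : A -> Prop) :
  (forall u v, P u -> Q v -> R (u * v)) ->
  forall u v, u \in lspan P -> v \in lspan Q -> u * v \in lspan R.
Proof.
move=> PQR u v /lspanP[s [Ps ->]] /lspanP[t [Qt ->]].
rewrite mulr_suml big_seq rpred_sum // => p /Ps Pp.
rewrite mulr_sumr big_seq rpred_sum // => q /Qt Qq.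
by rewrite -scalerAl -scalerAr !rpredZ //; apply/lspan_gen/PQR.
Qed.

(* The cohomology H^k of the sequence of maps D j -> D j.+2 given by
   multiplication by w, for subspaces D j of an algebra A. The sequence is a
   complex when these maps are well defined and w * w = 0, see
   [coboundaries_sub]. *)
Section Cohomology.
Variables (K : fieldType) (A : comAlgType K).
Variables (D : nat -> submodClosed A) (w : A).

Definition cocycles (k : nat) : {pred A} := fun u =>
  (u \in D k) && (w * u == 0).

Definition coboundaries (k : nat) : {pred A} := fun u =>
  if k is j.+2 then `[< exists2 v, v \in D j & u = w * v >]
  else u == 0.

Lemma cocycles_closed k : submod_closed (cocycles k).
Proof.
split; first by rewrite unfold_in rpred0 mulr0 eqxx.
move=> c u v /andP[uk /eqP wu] /andP[vk /eqP wv].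
by rewrite unfold_in rpredD ?rpredZ //= mulrDr -scalerAr wu wv scaler0 addr0.
Qed.
HB.instance Definition _ k :=
  GRing.isSubmodClosed.Build K A (cocycles k)
    (GRing.submod_closed_semi (cocycles_closed k)).

Lemma coboundaries_closed k : submod_closed (coboundaries k).
Proof.
case: k => [|[|k]].
- by split=> [|c u v /eqP-> /eqP->]; rewrite unfold_in ?scaler0 ?addr0.
- by split=> [|c u v /eqP-> /eqP->]; rewrite unfold_in ?scaler0 ?addr0.
split; first by apply/asboolP; exists 0; rewrite ?rpred0 ?mulr0.
move=> c _ _ /asboolP[u uk ->] /asboolP[v vk ->]; apply/asboolP.
by exists (c *: u + v); rewrite ?rpredD ?rpredZ // mulrDr scalerAr.
Qed.
HB.instance Definition _ k :=
  GRing.isSubmodClosed.Build K A (coboundaries k)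
    (GRing.submod_closed_semi (coboundaries_closed k)).

Lemma coboundaries_sub k :
  (forall j u, u \in D j -> w * u \in D j.+2) -> w * w = 0 ->
  {subset coboundaries k <= cocycles k}.
Proof.
move=> wD ww; case: k => [|[|k]] u.
- by move=> /eqP->; rewrite rpred0.
- by move=> /eqP->; rewrite rpred0.
move=> /asboolP[v vk ->]; rewrite unfold_in mulrA ww mul0r eqxx andbT.
exact: wD.
Qed.

Definition cocycle (k : nat) : Type := {u : A | u \in cocycles k}.
HB.instance Definition _ k := SubChoice.on (cocycle k).
HB.instance Definition _ k := [SubChoice_isSubLmodule of cocycle k by <:].

Definition coboundary (k : nat) : {pred cocycle k} := fun z =>
  val z \in coboundaries k.
Arguments coboundary : clear implicits.

Lemma coboundary_closed k : submod_closed (coboundary k).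
Proof.
split; first by rewrite unfold_in raddf0 rpred0.
move=> c u v uB vB; rewrite unfold_in.
have -> : val (c *: u + v) = c *: val u + val v by [].
by rewrite rpredD ?rpredZ.
Qed.
HB.instance Definition _ k :=
  GRing.isSubmodClosed.Build K (cocycle k) (coboundary k)
    (GRing.submod_closed_semi (coboundary_closed k)).

Definition cohomology (k : nat) : Type := {ideal_quot (coboundary k)}.
HB.instance Definition _ k := GRing.Zmodule.on (cohomology k).

Let coboundary_scale k : GRing.scaler_closed (coboundary k).
Proof. by move=> c z; apply: rpredZ. Qed.
HB.instance Definition _ k :=
  GRing.Zmodule_isLmodule.Build K (cohomology k)
    (quot_scaleA (@coboundary_scale k)) (quot_scale1 (@coboundary_scale k))
    (quot_scaleDr (@coboundary_scale k)) (quot_scaleDl (@coboundary_scale k)).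

End Cohomology.

Section DividedPowerAlgebra.
Variables (K : fieldType) (V : vectType K).

(* The polynomial ring over K in one variable for each symbol v^(a). *)
Definition dp_free : Type := {malg K[{cmonom (V * nat)%type}]}.
HB.instance Definition _ := GRing.ComAlgebra.on dp_free.

Definition dp_var : V -> nat -> dp_free :=
  locked (fun v a => << ucm (v, a) >>).

(* The remaining relation [v^(1) = v] is the identification of [v : V] with
   its image [dp v 1] in the algebra. *)
Inductive dp_relation : dp_free -> Prop :=
| DPrel0 v : dp_relation (dp_var v 0 - 1)
| DPrelM v a b :
    dp_relation (dp_var v a * dp_var v b - dp_var v (a + b) *+ 'C(a + b, a))
| DPrelZ t v a : dp_relation (dp_var (t *: v) a - t ^+ a *: dp_var v a)
| DPrelD u v a :
    dp_relation (dp_var (u + v) a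
                 - \sum_(i < a.+1) dp_var u i * dp_var v (a - i)).

Definition dp_ideal : {pred dp_free} := gen_ideal dp_relation.

Section Evaluation.
Variables (A : comAlgType K) (g : (V * nat)%type -> A).

Definition dp_eval_monom (m : {cmonom (V * nat)%type}) : A :=
  \prod_(i <- finsupp m) g i ^+ m i.

Lemma dp_eval_monomEw (m : {cmonom (V * nat)%type}) (d : {fset (V * nat)%type}) :
  (finsupp m `<=` d)%fset -> dp_eval_monom m = \prod_(i <- d) g i ^+ m i.
Proof.
move=> le; rewrite /dp_eval_monom [LHS](big_fset_incl _ le) => //= i _.
by rewrite -cmE_eq0 => /eqP->.
Qed.

Lemma dp_eval_monom_morph : mmorphism dp_eval_monom.
Proof.
split=> [m1 m2|]; last by rewrite /dp_eval_monom mdom1 big_seq_fset0.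
rewrite {1}/dp_eval_monom mdomD.
rewrite (@dp_eval_monomEw m1 _ (fsubsetUl _ (finsupp m2))).
rewrite (@dp_eval_monomEw m2 _ (fsubsetUr (finsupp m1) _)).
by rewrite -big_split /=; apply: eq_bigr => i _; rewrite cmM exprD.
Qed.
HB.instance Definition _ :=
  monalg.isMultiplicative.Build _ _ dp_eval_monom dp_eval_monom_morph.

Definition dp_eval : dp_free -> A := locked (mmap (in_alg A) dp_eval_monom).

Lemma dp_eval_is_zmod_morphism : zmod_morphism dp_eval.
Proof. by rewrite /dp_eval -lock; apply: mmap_is_additive. Qed.
HB.instance Definition _ :=
  GRing.isZmodMorphism.Build dp_free A dp_eval dp_eval_is_zmod_morphism.

Lemma dp_eval_is_monoid_morphism : monoid_morphism dp_eval.
Proof.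
rewrite /dp_eval -lock; split; first exact: mmap1.
by have [] := @mmap_is_multiplicative _ _ A (in_alg A) dp_eval_monom.
Qed.
HB.instance Definition _ :=
  GRing.isMonoidMorphism.Build dp_free A dp_eval dp_eval_is_monoid_morphism.

Lemma dp_eval_is_scalable : scalable dp_eval.
Proof. by move=> c p; rewrite /dp_eval -lock mmapZ mulr_algl. Qed.
HB.instance Definition _ :=
  GRing.isScalable.Build K dp_free A *:%R dp_eval dp_eval_is_scalable.

Lemma dp_eval_var v a : dp_eval (dp_var v a) = g (v, a).
Proof.
rewrite /dp_eval /dp_var -!lock mmapU /= scale1r mul1r /dp_eval_monom mdomU.
by rewrite big_seq_fset1 cmUU expr1.
Qed.

End Evaluation.

Lemma dp_ideal_proper : 1 \notin dp_ideal.
Proof.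
pose g (i : V * nat) : K^o := (i.2 == 0%N)%:R.
apply/negP => /(gen_ideal_kernel (h := dp_eval g)) g1.
suff /g1/eqP : forall p, dp_relation p -> dp_eval g p = 0.
  by rewrite rmorph1 oner_eq0.
move=> _ [v|v a b|t v a|u v a].
- by rewrite rmorphB /= dp_eval_var rmorph1 /g eqxx subrr.
- rewrite rmorphB rmorphM rmorphMn /= !dp_eval_var /g /= addn_eq0.
  by case: a b => [|a] [|b] //=; rewrite ?bin0 ?mul1r ?mul0r ?mul0rn subrr.
- rewrite rmorphB /= linearZ /= !dp_eval_var /g /=.
  by case: a => [|a] /=; rewrite ?expr0 ?scale1r ?scaler0 subrr.
- rewrite rmorphB rmorph_sum /= dp_eval_var.
  under eq_bigr => i _ do rewrite rmorphM /= !dp_eval_var.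
  rewrite big_ord_recl big1 => [|i _]; rewrite /g /= ?mul0r //.
  by rewrite subn0 mul1r addr0 subrr.
Qed.

HB.instance Definition _ :=
  isIdealr.Build dp_free dp_ideal (gen_ideal_closed dp_ideal_proper).

Definition divpow : Type := quot_alg dp_ideal.
HB.instance Definition _ := GRing.ComAlgebra.on divpow.

(* The divided power v^(a). *)
Definition dp (v : V) (a : nat) : divpow := quot_proj dp_ideal (dp_var v a).

Lemma dp_proj_relation p q : dp_relation (p - q) ->
  quot_proj dp_ideal p = quot_proj dp_ideal q.
Proof.
move=> /gen_ideal_rel; rewrite -/dp_ideal -quot_proj_eq0 rmorphB subr_eq0.
by move=> /eqP.
Qed.

Lemma dp0 v : dp v 0 = 1.
Proof. by rewrite /dp (dp_proj_relation (DPrel0 v)) rmorph1. Qed.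

Lemma dpM v a b : dp v a * dp v b = dp v (a + b) *+ 'C(a + b, a).
Proof.
by rewrite /dp -rmorphM /= (dp_proj_relation (DPrelM v a b)) raddfMn.
Qed.

Lemma dpZ t v a : dp (t *: v) a = t ^+ a *: dp v a.
Proof. by rewrite /dp (dp_proj_relation (DPrelZ t v a)) linearZ. Qed.

Lemma dpD u v a : dp (u + v) a = \sum_(i < a.+1) dp u i * dp v (a - i).
Proof.
rewrite /dp (dp_proj_relation (DPrelD u v a)) rmorph_sum.
by apply: eq_bigr => i _; rewrite rmorphM.
Qed.

(* Products v_1^(a_1) ... v_r^(a_r) with a_1 + ... + a_r = k. *)
Definition dp_monomial (k : nat) (u : divpow) : Prop :=
  exists2 s : seq (V * nat)%type,
    sumn [seq p.2 | p <- s] = k & u = \prod_(p <- s) dp p.1 p.2.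

(* D_k V, the degree k component of the grading in which v^(a) has degree a. *)
Definition divpow_deg (k : nat) : {pred divpow} := lspan (dp_monomial k).
HB.instance Definition _ k :=
  GRing.isSubmodClosed.Build K divpow (divpow_deg k)
    (GRing.submod_closed_semi (lspan_closed (dp_monomial k))).

Lemma divpow_degM j k u v :
  u \in divpow_deg j -> v \in divpow_deg k -> u * v \in divpow_deg (j + k).
Proof.
apply: lspanM => {u v} _ _ [s <- ->] [t <- ->]; exists (s ++ t).
  by rewrite map_cat sumn_cat.
by rewrite big_cat.
Qed.

Lemma divpow_deg_dp v a : dp v a \in divpow_deg a.
Proof.
by apply: lspan_gen; exists [:: (v, a)]; rewrite ?big_seq1 //= addn0.
Qed.

Section Omega.
Variables (m : nat) (x y : 'I_m -> V).

Definition dp_omega : divpow := \sum_(i < m) dp (x i) 1 * dp (y i) 1.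

Lemma dp_omega_deg : dp_omega \in divpow_deg 2.
Proof.
by rewrite rpred_sum // => i _; apply: (@divpow_degM 1 1); apply: divpow_deg_dp.
Qed.

Lemma dp_omega_sq : 2%N \in [pchar K] -> dp_omega * dp_omega = 0.
Proof.
move=> K2; have D2 : 2%N \in [pchar divpow].
  by rewrite inE /= -scaler_nat (pcharf0 K2) scale0r.
rewrite -expr2 -(pFrobenius_autE D2) rmorph_sum big1 //= => i _.
rewrite pFrobenius_autE exprMn expr2 dpM bin1 -mulr_natl (pcharf0 D2).
by rewrite !mul0r.
Qed.

Definition divpow_cohomology (k : nat) : lmodType K :=
  cohomology (fun j => divpow_deg j : submodClosed divpow) dp_omega k.

Lemma divpow_coboundaries_sub k : 2%N \in [pchar K] ->
  {subset coboundaries (fun j => divpow_deg j : submodClosed divpow) dp_omega k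
       <= cocycles (fun j => divpow_deg j : submodClosed divpow) dp_omega k}.
Proof.
move=> K2; apply: coboundaries_sub (dp_omega_sq K2) => j u.
exact: (@divpow_degM 2 j _ _ dp_omega_deg).
Qed.

End Omega.

End DividedPowerAlgebra.

Definition nondegenerate_form (K : fieldType) (V : vectType K)
    (f : V -> V -> K) : Prop :=
  forall u, (forall v, f u v = 0) -> u = 0.

Definition symplectic_basis (K : fieldType) (V : vectType K)
    (f : V -> V -> K) (m : nat) (x y : 'I_m -> V) : Prop :=
  basis_of fullv (codom x ++ codom y) /\
  forall i j, [/\ f (x i) (y j) = (i == j)%:R, f (x i) (x j) = 0
                & f (y i) (y j) = 0].

(* Main.v *)
From HB Require Import structures.
Require Import Defs.
From mathcomp Require Import all_boot all_order all_algebra.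
From mathcomp Require Import boolp.

Set Implicit Arguments.
Unset Strict Implicit.
Unset Printing Implicit Defensive.

Import GRing.Theory.
Local Open Scope ring_scope.

(** For a linear form lam on V let d_lam be the derivation of DV (contraction)
    with d_lam v^(a) = lam(v) v^(a-1). Write dx_i and dy_i for the contractions
    with the coordinate forms f(-, y_i) of x_i and f(x_i, -) of y_i, and
      E_i = x_i dx_i + y_i dy_i,
    the derivation that multiplies a monomial by its degree in x_i, y_i. The
    commutation rule ([dx_dy_omega])
      dx_i dy_i (omega p) = p + E_i p + omega (dx_i dy_i p)
    says that dx_i dy_i is a homotopy between E_i and the identity (signs do not
    matter in characteristic 2), so each E_i acts as the identity on cohomology
    ([pair_degree_cohomologous]).

    Vanishing. The product E_1 ... E_m kills D_k V when k < m
    ([iter_pair_degree_eq0]): up to moving multiplications to the left, it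
    contracts m times an element of degree less than m. As it is also the
    identity on cohomology, H^k = 0. The sum E_1 + ... + E_m is multiplication
    by k on D_k V by the Euler relation ([sum_pair_degree]), and multiplication
    by m on H^k; hence H^k = 0 when k - m is odd, that is, invertible in K.

    Non-vanishing. When k >= m has the parity of m, the monomial
    x_1^(k-m+1) x_2 ... x_m has odd exponents only, so omega annihilates it:
    x_i x_i^(c) = (c+1) x_i^(c+1). It is no multiple of omega, because it
    survives in the quotient of DV where every y_i is 0, and omega does not.

    Both the contractions and this last fact need algebra morphisms out of DV.
    They come from one construction: DV is mapped to words by Taylor expansion
    v^(a) -> sum_w lam_w(v) v^(a-|w|) w, with w ranging over words of linear
    forms, and this is multiplicative for the shuffle product on words
    ([dp_system_taylor]). Contractions are the coefficients at words of length
    1; keeping only the terms with |w| = a sends divided powers to symmetric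
    tensors, where nonzero monomials are recognized by their coefficients. *)

(** * Multiples in characteristic 2 *)

Lemma char2_mulrn_odd (R : nzRingType) (R2 : 2%N \in [pchar R]) n (a : R) :
  odd n -> a *+ n = a.
Proof.
move=> n1; rewrite -(odd_double_half n) n1 mulrS -mul2n mulrnA.
by rewrite (mulrn_pchar R2) mul0rn addr0.
Qed.

(** * The shuffle algebra *)

Section ShuffleAlgebra.
Variables (K : fieldType) (I : Type) (A : comAlgType K).

(** Noncommutative power series in the letters I, given by their coefficients,
    under the shuffle product. *)
Definition shuffle_alg : Type := seq I -> A.
HB.instance Definition _ := gen_eqMixin shuffle_alg.
HB.instance Definition _ := gen_choiceMixin shuffle_alg.

Implicit Types (f g h : shuffle_alg) (i : I) (w : seq I) (c : K).

Definition sh_deriv i f : shuffle_alg := fun w => f (i :: w).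
Definition sh_zero : shuffle_alg := fun _ => 0.
Definition sh_one : shuffle_alg := fun w => (nilp w)%:R.
Definition sh_opp f : shuffle_alg := fun w => - f w.
Definition sh_add f g : shuffle_alg := fun w => f w + g w.
Definition sh_scale c f : shuffle_alg := fun w => c *: f w.

(** The shuffle product is the one for which taking the coefficients of the words
    starting with i is a derivation for each letter i. With this rule as the
    definition, every ring law follows by induction on words. *)
Fixpoint sh_eval_mul f g w : A :=
  if w is i :: w' then
    sh_eval_mul (sh_deriv i f) g w' + sh_eval_mul f (sh_deriv i g) w'
  else f [::] * g [::].
Definition sh_mul f g : shuffle_alg := sh_eval_mul f g.

Fact sh_addA : associative sh_add.
Proof. by move=> f g h; apply/funext => w; apply: addrA. Qed.
Fact sh_addC : commutative sh_add.
Proof. by move=> f g; apply/funext => w; apply: addrC. Qed.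
Fact sh_add0 : left_id sh_zero sh_add.
Proof. by move=> f; apply/funext => w; apply: add0r. Qed.
Fact sh_addN : left_inverse sh_zero sh_opp sh_add.
Proof. by move=> f; apply/funext => w; apply: addNr. Qed.
HB.instance Definition _ := GRing.isZmodule.Build shuffle_alg
  sh_addA sh_addC sh_add0 sh_addN.

Fact sh_mulC : commutative sh_mul.
Proof.
move=> f g; apply/funext => w; rewrite /sh_mul.
elim: w f g => [|i w IHw] f g /=; first exact: mulrC.
by rewrite addrC (IHw f) (IHw (sh_deriv i f)).
Qed.

Fact sh_mulDl : left_distributive sh_mul sh_add.
Proof.
move=> f g h; apply/funext => w; rewrite /sh_mul /sh_add.
elim: w f g h => [|i w IHw] f g h /=; first exact: mulrDl.
by rewrite addrACA -!IHw.
Qed.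

Fact sh_mulA : associative sh_mul.
Proof.
have sh_mulDr : right_distributive sh_mul sh_add.
  by move=> f g h; rewrite !(sh_mulC f) sh_mulDl.
move=> f g h; apply/funext => w.
elim: w f g h => [|i w IHw] f g h; first exact: mulrA.
transitivity ((sh_mul (sh_deriv i f) (sh_mul g h) w)
  + sh_mul f (sh_add (sh_mul (sh_deriv i g) h) (sh_mul g (sh_deriv i h))) w).
  by [].
transitivity (
  sh_mul (sh_add (sh_mul (sh_deriv i f) g) (sh_mul f (sh_deriv i g))) h w
    + sh_mul (sh_mul f g) (sh_deriv i h) w); last by [].
by rewrite sh_mulDl sh_mulDr /sh_add -!IHw addrA.
Qed.

Fact sh_mul1 : left_id sh_one sh_mul.
Proof.
have mul0 f : sh_mul sh_zero f = sh_zero.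
  have := sh_mulDl sh_zero sh_zero f; rewrite sh_add0 => /esym/eqP.
  by rewrite -[X in _ == X]sh_add0 => /eqP/(@addIr shuffle_alg).
move=> f; apply/funext => w.
elim: w f => [|i w IHw] f; first exact: mul1r.
transitivity (sh_mul sh_zero f w + sh_mul sh_one (sh_deriv i f) w); first by [].
by rewrite IHw mul0 [LHS]add0r.
Qed.

Fact sh_one_neq0 : sh_one != 0.
Proof.
by apply/eqP => /(congr1 (fun f : shuffle_alg => f [::]))/eqP; apply/negP/oner_neq0.
Qed.

HB.instance Definition _ := GRing.Zmodule_isComNzRing.Build shuffle_alg
  sh_mulA sh_mulC sh_mul1 sh_mulDl sh_one_neq0.

Fact sh_scaleA a b f : sh_scale a (sh_scale b f) = sh_scale (a * b) f.
Proof. by apply/funext => w; apply: scalerA. Qed.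
Fact sh_scale1 : left_id 1 sh_scale.
Proof. by move=> f; apply/funext => w; apply: scale1r. Qed.
Fact sh_scaleDr : right_distributive sh_scale +%R.
Proof. by move=> c f g; apply/funext => w; apply: scalerDr. Qed.
Fact sh_scaleDl f : {morph sh_scale^~ f : a b / a + b}.
Proof. by move=> a b; apply/funext => w; apply: scalerDl. Qed.
HB.instance Definition _ := GRing.Zmodule_isLmodule.Build K shuffle_alg
  sh_scaleA sh_scale1 sh_scaleDr sh_scaleDl.

Fact sh_scaleAl c f g : c *: (f * g) = c *: f * g.
Proof.
apply/funext => w; elim: w f g => [|i w IHw] f g; first exact: scalerAl.
transitivity ((c *: (sh_deriv i f * g)) w + (c *: (f * sh_deriv i g)) w).
  exact: scalerDr.
by rewrite !IHw.
Qed.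
HB.instance Definition _ :=
  GRing.Lmodule_isLalgebra.Build K shuffle_alg sh_scaleAl.
HB.instance Definition _ := GRing.Lalgebra_isComAlgebra.Build K shuffle_alg.

Definition sh_coef w f : A := f w.
Fact sh_coef_linear w : linear (sh_coef w). Proof. by []. Qed.
HB.instance Definition _ w :=
  GRing.isLinear.Build K shuffle_alg A *:%R (sh_coef w) (sh_coef_linear w).
Fact sh_deriv_linear i : linear (sh_deriv i). Proof. by []. Qed.
HB.instance Definition _ i := GRing.isLinear.Build K shuffle_alg shuffle_alg
  *:%R (sh_deriv i) (sh_deriv_linear i).

Lemma sh_coef_cons i w f : sh_coef (i :: w) f = sh_coef w (sh_deriv i f).
Proof. by []. Qed.

Lemma sh_coefZ w c f : sh_coef w (c *: f) = c *: sh_coef w f.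
Proof. by []. Qed.

Lemma sh_derivZ i c f : sh_deriv i (c *: f) = c *: sh_deriv i f.
Proof. by []. Qed.

Lemma sh_coef_nilM f g : sh_coef [::] (f * g) = sh_coef [::] f * sh_coef [::] g.
Proof. by []. Qed.

Lemma sh_coef1 w : sh_coef w 1 = (nilp w)%:R.
Proof. by []. Qed.

Lemma sh_derivM i f g :
  sh_deriv i (f * g) = sh_deriv i f * g + f * sh_deriv i g.
Proof. by []. Qed.

Lemma sh_deriv1 i : sh_deriv i 1 = 0.
Proof. by []. Qed.

Lemma sh_coefP f g : (forall w, sh_coef w f = sh_coef w g) -> f = g.
Proof. by move=> fg; apply/funext. Qed.

End ShuffleAlgebra.

Arguments sh_coef : simpl never.
Arguments sh_deriv : simpl never.

(** * Morphisms out of the divided power algebra *)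

Section UniversalProperty.
Variables (K : fieldType) (V : vectType K).

Record dp_system (A : comAlgType K) (g : V -> nat -> A) : Prop := DpSystem {
  dp_sys0 : forall v, g v 0 = 1;
  dp_sysM : forall v a b, g v a * g v b = g v (a + b)%N *+ 'C(a + b, a);
  dp_sysZ : forall t v a, g (t *: v) a = t ^+ a *: g v a;
  dp_sysD : forall u v a, g (u + v) a = \sum_(i < a.+1) g u i * g v (a - i)%N
}.

Lemma dp_system_dp : dp_system (@dp K V).
Proof.
by split; [apply: dp0 | apply: dpM | apply: dpZ | apply: dpD].
Qed.

(** The system of the augmentation DV -> A, which sends all of V to 0. *)
Lemma dp_system_aug (A : comAlgType K) :
  dp_system (fun (_ : V) a => (a == 0)%:R : A).
Proof.
split=> [//|_ a b|t _ a|_ _ a] /=.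
- by rewrite addn_eq0; case: a b => [|a] [|b]; rewrite ?bin0 ?mul1r ?mul0r ?mul0rn.
- by case: a => [|a]; rewrite ?expr0 ?scale1r ?scaler0.
- rewrite big_ord_recl big1 => [|i _] /=; rewrite ?mul0r //.
  by rewrite subn0 mul1r addr0.
Qed.

Section Lift.
Variables (A : comAlgType K) (g : V -> nat -> A).
Hypothesis gP : dp_system g.

Let ev : dp_free V -> A := dp_eval (fun p => g p.1 p.2).

Let ev_ideal p : p \in @dp_ideal K V -> ev p = 0.
Proof.
apply: gen_ideal_kernel => {}p [v|v a b|t v a|u v a].
- by rewrite rmorphB /= dp_eval_var rmorph1 (dp_sys0 gP) subrr.
- by rewrite rmorphB rmorphM rmorphMn /= !dp_eval_var (dp_sysM gP) subrr.
- by rewrite rmorphB /= linearZ /= !dp_eval_var (dp_sysZ gP) subrr.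
- rewrite rmorphB rmorph_sum /= dp_eval_var (dp_sysD gP).
  under [X in _ - X]eq_bigr => i _ do rewrite rmorphM /= !dp_eval_var.
  by rewrite subrr.
Qed.

(** The proof argument, although absent from the value, lets the morphism
    structures below be inferred. *)
Definition dp_lift of dp_system g := fun u : divpow V =>
  ev (generic_quotient.repr (u : Quotient.quot (@dp_ideal K V))).

Local Notation lift := (dp_lift gP).

Let dp_liftE p : lift (quot_proj (@dp_ideal K V) p) = ev p.
Proof.
apply/eqP; rewrite -subr_eq0 /dp_lift -rmorphB; apply/eqP/ev_ideal.
rewrite -quot_proj_eq0 rmorphB subr_eq0; apply/eqP.
exact: generic_quotient.reprK.
Qed.

Fact dp_lift_linear : linear lift.
Proof.
move=> c u v; have [p ->] := quot_proj_surj u; have [q ->] := quot_proj_surj v.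
by rewrite -linearP !dp_liftE /ev linearP.
Qed.
HB.instance Definition _ :=
  GRing.isLinear.Build K (divpow V) A *:%R lift dp_lift_linear.

Fact dp_lift_monoid_morphism : monoid_morphism lift.
Proof.
split=> [|u v]; first by rewrite -(rmorph1 (quot_proj _)) dp_liftE /ev rmorph1.
have [p ->] := quot_proj_surj u; have [q ->] := quot_proj_surj v.
by rewrite -rmorphM !dp_liftE /ev rmorphM.
Qed.
HB.instance Definition _ :=
  GRing.isMonoidMorphism.Build (divpow V) A lift dp_lift_monoid_morphism.

Lemma dp_lift_dp v a : lift (dp v a) = g v a.
Proof. by rewrite dp_liftE /ev dp_eval_var. Qed.

End Lift.

Section Taylor.
Variables (I : Type) (lam : I -> {scalar V}).
Variables (A : comAlgType K) (g : V -> nat -> A).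
Hypothesis gP : dp_system g.

(** The Taylor expansion of g, that is, v^(a) moved by v -> v + sum_i lam_i(v) i.
    The divided power (sum_i lam_i(v) i)^(b) for the shuffle product is the sum
    of all words of length b, each weighted by the product of the lam_i(v) over
    its letters. For g the augmentation only words of length a remain, and v^(a)
    becomes a symmetric tensor, the a-th tensor power of sum_i lam_i(v) i. *)
Definition dp_taylor v a : shuffle_alg I A := fun w =>
  if (size w <= a)%N then (\prod_(i <- w) lam i v) *: g v (a - size w)%N else 0.

Lemma sh_coef_taylor w v a : sh_coef w (dp_taylor v a) =
  if (size w <= a)%N then (\prod_(i <- w) lam i v) *: g v (a - size w)%N else 0.
Proof. by []. Qed.

Lemma dp_taylor_nil v a : sh_coef [::] (dp_taylor v a) = g v a.
Proof. by rewrite sh_coef_taylor big_nil scale1r subn0. Qed.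

Lemma dp_taylor0 v : dp_taylor v 0 = 1.
Proof.
apply: sh_coefP => -[|i w]; last by [].
by rewrite dp_taylor_nil (dp_sys0 gP).
Qed.

(** Together with the constant coefficient, this recursion determines the
    expansion; all the relations of divided powers follow from it by induction
    on words, Pascal's rule giving the binomial coefficients. *)
Lemma sh_deriv_taylor i v a :
  sh_deriv i (dp_taylor v a.+1) = lam i v *: dp_taylor v a.
Proof.
apply: sh_coefP => w; rewrite linearZ /= -sh_coef_cons !sh_coef_taylor /= ltnS.
by rewrite subSS big_cons -scalerA; case: ifP; rewrite ?scaler0.
Qed.

Lemma dp_system_taylor : dp_system dp_taylor.
Proof.
split.
- exact: dp_taylor0.
- move=> v a b; apply: sh_coefP => w; elim: w a b => [|i w IHw] a b.
    by rewrite sh_coef_nilM linearMn /= !dp_taylor_nil (dp_sysM gP).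
  case: a b => [|a] [|b].
  + by rewrite dp_taylor0 mul1r.
  + by rewrite dp_taylor0 mul1r.
  + by rewrite dp_taylor0 mulr1 addn0 binn.
  rewrite addnS binS !sh_coef_cons linearMn /= sh_derivM !sh_deriv_taylor.
  rewrite -scalerAl -scalerAr -scalerDr mulrnDr !linearZ linearD /= !IHw.
  by rewrite -linearD -linearZ /= addnS addSn addrC scalerDr !scalerMnr.
- move=> t v a; apply: sh_coefP => w; elim: w a => [|i w IHw] a.
    by rewrite linearZ /= !dp_taylor_nil (dp_sysZ gP).
  case: a => [|a]; first by rewrite !dp_taylor0 expr0 scale1r.
  rewrite !sh_coef_cons sh_derivZ !sh_deriv_taylor !sh_coefZ IHw sh_coefZ.
  by rewrite (linearZ_LR (lam i)) !scalerA exprSr mulrC mulrA.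
- move=> u v a; apply: sh_coefP => w; elim: w a => [|i w IHw] a.
    rewrite linear_sum /= dp_taylor_nil (dp_sysD gP).
    by apply: eq_bigr => j _; rewrite sh_coef_nilM !dp_taylor_nil.
  case: a => [|a].
    by rewrite big_ord1 !dp_taylor0 mulr1.
  rewrite !sh_coef_cons sh_deriv_taylor linear_sum /=.
  under eq_bigr => j _ do rewrite sh_derivM.
  rewrite big_split linearD sh_coefZ IHw -sh_coefZ linearD /=.
  rewrite [in RHS]big_ord_recl [dp_taylor u _]dp_taylor0 sh_deriv1 mul0r add0r.
  rewrite [X in _ = _ + sh_coef w X]big_ord_recr /= subnn dp_taylor0 sh_deriv1.
  rewrite mulr0 addr0 -[RHS]linearD scalerDl !scaler_sumr /=; congr (sh_coef w (_ + _)).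
    by apply: eq_bigr => j _; rewrite sh_deriv_taylor scalerAl.
  apply: eq_bigr => j _.
  by rewrite subSn ?leq_ord // sh_deriv_taylor scalerAr.
Qed.

End Taylor.
End UniversalProperty.

(** * Contraction with a linear form *)

Section Contraction.
Variables (K : fieldType) (V : vectType K).
Implicit Types (lam : {scalar V}) (u v : V) (p q : divpow V).

Let taylor lam : divpow V -> shuffle_alg unit (divpow V) :=
  dp_lift (dp_system_taylor (fun=> lam) (dp_system_dp V)).

(** The first order term of the Taylor expansion along lam. *)
Definition contract lam p : divpow V := sh_coef [:: tt] (taylor lam p).

Fact contract_linear lam : linear (contract lam).
Proof. by move=> c p q; rewrite /contract /taylor !linearP. Qed.
HB.instance Definition _ lam := GRing.isLinear.Build K (divpow V) (divpow V)
  *:%R (contract lam) (contract_linear lam).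

Lemma divpow_deg_ind k (P : divpow V -> Prop) :
    (forall c p q, P p -> P q -> P (c *: p + q)) -> P 0 ->
    (forall s : seq (V * nat), sumn [seq x.2 | x <- s] = k ->
       P (\prod_(x <- s) dp x.1 x.2)) ->
  forall p, p \in divpow_deg k -> P p.
Proof.
move=> Plin P0 Pmon p /lspanP[s [sP ->]].
elim: s sP => [|t s IHs] sP; first by rewrite big_nil.
rewrite big_cons; apply: Plin; last first.
  by apply: IHs => x xs; apply: sP; rewrite inE xs orbT.
by have [|r rk ->] := sP t; [rewrite inE eqxx | apply: Pmon].
Qed.

Let taylor_nil lam k p : p \in divpow_deg k -> sh_coef [::] (taylor lam p) = p.
Proof.
move: p; apply: divpow_deg_ind => [c p q Pp Pq||s _].
- by rewrite /taylor in Pp Pq *; rewrite !linearP /= Pp Pq.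
- by rewrite /taylor !linear0.
rewrite /taylor rmorph_prod /=; elim: s => [|x s IHs].
  by rewrite !big_nil sh_coef1.
by rewrite !big_cons sh_coef_nilM IHs dp_lift_dp dp_taylor_nil.
Qed.

Lemma contract1 lam : contract lam 1 = 0.
Proof. by rewrite /contract /taylor rmorph1 sh_coef1. Qed.

Lemma contract_dp lam v a : contract lam (dp v a.+1) = lam v *: dp v a.
Proof.
rewrite /contract /taylor dp_lift_dp sh_coef_cons sh_deriv_taylor sh_coefZ.
by rewrite dp_taylor_nil.
Qed.

(** The first order term of a product is given by the Leibniz rule up to replacing
    p and q by the constant terms of their expansions. These constant terms are p
    and q, as one sees on monomials; hence the homogeneity hypotheses. *)
Lemma contractM lam j k p q : p \in divpow_deg j -> q \in divpow_deg k ->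
  contract lam (p * q) = contract lam p * q + p * contract lam q.
Proof.
move=> /(taylor_nil lam) pE /(taylor_nil lam) qE.
rewrite /contract /taylor rmorphM in pE qE *.
by rewrite !sh_coef_cons sh_derivM linearD /= !sh_coef_nilM pE qE.
Qed.

Lemma contract_deg0 lam p : p \in divpow_deg 0 -> contract lam p = 0.
Proof.
move: p; apply: divpow_deg_ind => [c p q Pp Pq||s].
- by rewrite linearP /= Pp Pq scaler0 addr0.
- by rewrite linear0.
elim: s => [|[v a] s IHs] /=; first by rewrite big_nil contract1.
move/eqP; rewrite addn_eq0 => /andP[/eqP-> /eqP/IHs].
by rewrite big_cons dp0 mul1r.
Qed.

Lemma contract_deg lam k p :
  p \in divpow_deg k.+1 -> contract lam p \in divpow_deg k.
Proof.
move: p; apply: divpow_deg_ind => [c p q Pp Pq||s].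
- by rewrite linearP /= rpredD ?rpredZ.
- by rewrite linear0 rpred0.
elim: s k => [|[v [|a]] s IHs] k //=.
  by rewrite add0n big_cons dp0 mul1r; apply: IHs.
rewrite addSn => -[<-]; set n := sumn _; rewrite big_cons.
have sn : \prod_(x <- s) dp x.1 x.2 \in divpow_deg n.
  by apply: lspan_gen; exists s.
rewrite (contractM _ (divpow_deg_dp v a.+1) sn) contract_dp -scalerAl rpredD //.
  by rewrite rpredZ // divpow_degM // divpow_deg_dp.
rewrite {}/n in sn *; case n: (sumn _) sn => [|n'] sn.
  by rewrite contract_deg0 // mulr0 rpred0.
by rewrite addnS -addSn divpow_degM ?divpow_deg_dp // IHs.
Qed.

Lemma contract_mul1 lam v k p : p \in divpow_deg k ->
  contract lam (dp v 1 * p) = lam v *: p + dp v 1 * contract lam p.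
Proof.
move=> pk; rewrite (contractM _ (divpow_deg_dp v 1) pk) contract_dp dp0.
by rewrite -scalerAl mul1r.
Qed.

End Contraction.

(** * Pair degrees and the homotopy *)

Section AlgebraIdentities.
Variables (K : fieldType) (A : comAlgType K).
Implicit Types (X Y p q r s t u : A) (a b : K).

Lemma leibniz_mulV a b X Y p q :
  a *: (Y * p) + X * (b *: p + Y * q) = (a *: Y + b *: X) * p + X * Y * q.
Proof. by rewrite mulrDr addrA mulrA mulrDl -!scalerAl -scalerAr. Qed.

Lemma leibniz_pair X Y p q r s t u :
  X * (r * q + p * s) + Y * (t * q + p * u)
  = (X * r + Y * t) * q + p * (X * s + Y * u).
Proof. by rewrite !mulrDr !mulrDl !(mulrCA p) !mulrA addrACA. Qed.

Lemma mulr_scaleA a X p : X * (a *: p) = (a *: X) * p.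
Proof. by rewrite -scalerAr scalerAl. Qed.

Lemma addr_mul0 X Y p q : p = 0 -> q = 0 -> X * p + Y * q = 0.
Proof. by move=> -> ->; rewrite !mulr0 addr0. Qed.

Lemma mulrACA_eq0 X Y p q : X * p = 0 -> X * Y * (p * q) = 0.
Proof. by move=> Xp; rewrite mulrACA Xp mul0r. Qed.

End AlgebraIdentities.

Section Symplectic.
Variables (K : fieldType) (V : vectType K).
Variable f : {bilinear V -> V -> K | *%R & *%R}.
Variables (m : nat) (x y : 'I_m -> V).
Hypothesis xy_basis : symplectic_basis f x y.

(** The two sides agree on the basis, and both are linear in v. *)
Lemma symplectic_expansion v :
  v = \sum_i (f v (y i) *: x i + f (x i) v *: y i).
Proof.
have [/andP[/eqP full _] fxy] := xy_basis.
have: v \in <<codom x ++ codom y>>%VS by rewrite full memvf.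
pose P u := u = \sum_i (f u (y i) *: x i + f (x i) u *: y i).
suff PX t : t \in codom x ++ codom y -> P t.
  move=> /(coord_span (X := in_tuple _)) ->.
  apply: (big_ind P) => [|u1 u2 P1 P2|t _].
  - by rewrite /P big1 // => i _; rewrite linear0l linear0r !scale0r addr0.
  - rewrite /P {1}P1 {1}P2 -big_split; apply: eq_bigr => i _ /=.
    by rewrite linearDl linearDr !scalerDl addrACA.
  set u := _`_t; have Pu : P u by apply/PX/mem_nth.
  rewrite /P {1}Pu scaler_sumr; apply: eq_bigr => i _.
  by rewrite linearZl_LR linearZr_LR scalerDr !scalerA.
rewrite mem_cat => /orP[] /codomP[j ->]; rewrite /P (bigD1 j) //= big1.
- have [-> -> _] := fxy j j.
  by rewrite eqxx scale1r scale0r !addr0.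
- move=> i /negPf ij; have [_ -> _] := fxy i j; have [-> _ _] := fxy j i.
  by rewrite eq_sym ij !scale0r addr0.
- have [-> _ ->] := fxy j j.
  by rewrite eqxx scale1r scale0r addr0 add0r.
- move=> i /negPf ij; have [-> _ _] := fxy i j; have [_ _ ->] := fxy j i.
  by rewrite ij !scale0r addr0.
Qed.

(** The derivations with respect to x_i and y_i: the form paired against y_i is
    the coordinate of x_i, and conversely. *)
Definition dx i : divpow V -> divpow V := contract (applyr f (y i)).
Definition dy i : divpow V -> divpow V := contract (f (x i)).
HB.instance Definition _ i := GRing.Linear.on (dx i).
HB.instance Definition _ i := GRing.Linear.on (dy i).

(** In the monomial basis this is the diagonal operator multiplying a monomial by
    its total exponent in x_i and y_i. *)
Definition pair_degree i p : divpow V :=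
  dp (x i) 1 * dx i p + dp (y i) 1 * dy i p.

Fact pair_degree_linear i : linear (pair_degree i).
Proof.
move=> c p q; rewrite /pair_degree !linearP /= !mulrDr -!scalerAr scalerDr.
by rewrite addrACA.
Qed.
HB.instance Definition _ i := GRing.isLinear.Build K (divpow V) (divpow V)
  *:%R (pair_degree i) (pair_degree_linear i).

Lemma pair_degree_deg i k p :
  p \in divpow_deg k -> pair_degree i p \in divpow_deg k.
Proof.
case: k => [|k] pk.
  by rewrite /pair_degree /dx /dy !contract_deg0 // !mulr0 addr0 rpred0.
by rewrite -[k.+1]add1n rpredD // divpow_degM ?divpow_deg_dp ?contract_deg.
Qed.

Local Notation omega := (dp_omega x y).

Let pairing := xy_basis.2.

Lemma contract_omega (lam : {scalar V}) k p : p \in divpow_deg k ->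
  contract lam (omega * p) =
    (\sum_j (lam (x j) *: dp (y j) 1 + lam (y j) *: dp (x j) 1)) * p
    + omega * contract lam p.
Proof.
move=> pk; rewrite mulr_suml linear_sum !mulr_suml -big_split /=.
apply: eq_bigr => j _; rewrite -mulrA.
rewrite (@contract_mul1 _ _ _ _ (1 + k)) ?divpow_degM ?divpow_deg_dp //.
rewrite (contract_mul1 _ _ pk).
exact: leibniz_mulV.
Qed.

Lemma dx_omega i k p : p \in divpow_deg k ->
  dx i (omega * p) = dp (y i) 1 * p + omega * dx i p.
Proof.
move=> pk; rewrite /dx (contract_omega _ pk); congr (_ * _ + _).
rewrite (bigD1 i) //= big1 => [|j /negPf ji].
  have [-> _ ->] := pairing i i.
  by rewrite eqxx scale1r scale0r !addr0.
have [-> _ ->] := pairing j i.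
by rewrite ji !scale0r addr0.
Qed.

Lemma dy_omega i k p : p \in divpow_deg k ->
  dy i (omega * p) = dp (x i) 1 * p + omega * dy i p.
Proof.
move=> pk; rewrite /dy (contract_omega _ pk); congr (_ * _ + _).
rewrite (bigD1 i) //= big1 => [|j /negPf ji].
  have [-> -> _] := pairing i i.
  by rewrite eqxx scale1r scale0r add0r addr0.
have [-> -> _] := pairing i j.
by rewrite eq_sym ji !scale0r addr0.
Qed.

(** The canonical commutation relation: dx_i dy_i is second order, and the
    commutator with omega = ... + x_i y_i + ... collects the term 1 in which both
    derivatives hit omega and the two mixed terms x_i dx_i and y_i dy_i. *)
Lemma dx_dy_omega i k p : p \in divpow_deg k ->
  dx i (dy i (omega * p)) = p + pair_degree i p + omega * dx i (dy i p).
Proof.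
move=> pk; rewrite (dy_omega _ pk) linearD /= {1}/dx (contract_mul1 _ _ pk) /=.
have [-> _ _] := pairing i i; rewrite eqxx scale1r -!addrA; congr (_ + (_ + _)).
case: k pk => [|k] pk.
  by rewrite /dy contract_deg0 // linear0 !mulr0 linear0 addr0.
by rewrite (dx_omega _ (contract_deg _ pk)).
Qed.

Lemma pair_degreeM i j k p q : p \in divpow_deg j -> q \in divpow_deg k ->
  pair_degree i (p * q) = pair_degree i p * q + p * pair_degree i q.
Proof.
move=> pj qk; rewrite /pair_degree /dx /dy !(contractM _ pj qk).
exact: leibniz_pair.
Qed.

Lemma dp1_linear : linear (fun v : V => dp v 1).
Proof.
by move=> c u v; rewrite dpD !big_ord_recl big_ord0 /= !dp0 mul1r mulr1 addr0 dpZ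
  addrC.
Qed.

Lemma sum_pair_degree_dp v a : \sum_i pair_degree i (dp v a) = dp v a *+ a.
Proof.
case: a => [|a].
  rewrite mulr0n big1 // => i _.
  by rewrite /pair_degree /dx /dy dp0 !contract1 !mulr0 addr0.
pose dp1 : V -> divpow V := fun u => dp u 1.
pose dp1L := GRing.isLinear.Build K V (divpow V) *:%R dp1 dp1_linear.
pose dp1l : {linear V -> divpow V} := HB.pack dp1 dp1L.
have -> : dp v a.+1 *+ a.+1 = dp1l v * dp v a by rewrite /= /dp1 dpM add1n bin1.
rewrite {2}[v]symplectic_expansion linear_sum mulr_suml; apply: eq_bigr => i _.
rewrite linearD !linearZ /= mulrDl /pair_degree /dx /dy !contract_dp /=.
by congr (_ + _); apply: mulr_scaleA.
Qed.

(** Euler's relation. Both sides are derivations in p, so v^(a) suffices; there the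
    left side is v v^(a-1), by expanding v in the symplectic basis. *)
Lemma sum_pair_degree k p :
  p \in divpow_deg k -> \sum_i pair_degree i p = p *+ k.
Proof.
move: p; apply: divpow_deg_ind => [c p q Pp Pq||s <-].
- under eq_bigr => i _ do rewrite linearP.
  by rewrite big_split -scaler_sumr /= Pp Pq mulrnDl scalerMnr.
- by rewrite mul0rn big1 // => i _; rewrite linear0.
elim: s => [|[v a] s IHs] /=.
  rewrite big_nil mulr0n big1 // => i _.
  by rewrite /pair_degree /dx /dy !contract1 !mulr0 addr0.
rewrite big_cons /=; set n := sumn _ in IHs *.
have sn : \prod_(t <- s) dp t.1 t.2 \in divpow_deg n by apply: lspan_gen; exists s.
under eq_bigr => i _ do rewrite (pair_degreeM i (divpow_deg_dp v a) sn).
rewrite big_split /= -mulr_suml -mulr_sumr IHs sum_pair_degree_dp.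
by rewrite mulrnAl mulrnAr mulrnDr.
Qed.

(** The head of s acts first. *)
Definition iter_pair_degree (s : seq 'I_m) p :=
  foldl (fun q i => pair_degree i q) p s.

Lemma iter_pair_degreeD s : {morph iter_pair_degree s : p q / p + q}.
Proof. by elim: s => [|i s IHs] p q //=; rewrite linearD IHs. Qed.

Lemma iter_pair_degree_dp1 s v k p :
    (forall i, i \in s -> f v (y i) = 0 /\ f (x i) v = 0) ->
  p \in divpow_deg k ->
  iter_pair_degree s (dp v 1 * p) = dp v 1 * iter_pair_degree s p.
Proof.
elim: s p => [|i s IHs] p //= vs pk.
rewrite (pair_degreeM i (divpow_deg_dp v 1) pk).
have [vy xv] := vs i (mem_head _ _).
rewrite {1}/pair_degree /dx /dy !contract_dp /= vy xv !scale0r !mulr0 addr0 mul0r.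
rewrite add0r IHs ?pair_degree_deg // => j js.
by apply: vs; rewrite inE js orbT.
Qed.

(** Since x_i and y_i are constants for every E_j with j <> i, the outer E_j commute
    with them, and E_i only lowers the degree of the argument of the remaining
    operators. Each operator costs one degree, and k < size s runs out. *)
Lemma iter_pair_degree_eq0 s k p : uniq s -> (k < size s)%N ->
  p \in divpow_deg k -> iter_pair_degree s p = 0.
Proof.
have E0 t : iter_pair_degree t 0 = 0.
  by elim: t => //= i t IHt; rewrite linear0.
elim: s k p => [|i s IHs] [|k] p //= /andP[is_ us] ks pk; rewrite {1}/pair_degree.
  by rewrite /dx /dy !contract_deg0 // !mulr0 addr0 E0.
have zs j : j \in s -> i == j = false by move=> js; apply: contraNF is_ => /eqP->.
rewrite iter_pair_degreeD.
have dxk : dx i p \in divpow_deg k by apply: contract_deg.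
have dyk : dy i p \in divpow_deg k by apply: contract_deg.
have xs j : j \in s -> f (x i) (y j) = 0 /\ f (x j) (x i) = 0.
  by move=> /zs ij; have [-> _ _] := pairing i j; have [_ -> _] := pairing j i;
    rewrite ij.
have ys j : j \in s -> f (y i) (y j) = 0 /\ f (x j) (y i) = 0.
  by move=> /zs ij; have [-> _ _] := pairing j i; have [_ _ ->] := pairing i j;
    rewrite eq_sym ij.
apply: etrans (congr2 +%R (iter_pair_degree_dp1 xs dxk)
  (iter_pair_degree_dp1 ys dyk)) _.
exact: addr_mul0 (IHs k _ us ks dxk) (IHs k _ us ks dyk).
Qed.

Local Notation D := (fun j => divpow_deg j : submodClosed (divpow V)).

(** When omega p = 0 the commutation relation exhibits p + E_i p as omega times
    - dx_i dy_i p. In degrees 0 and 1 the second derivative vanishes, in agreement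
    with the convention that there are no nonzero coboundaries there. *)
Lemma pair_degree_cohomologous i k p : p \in cocycles D omega k ->
  p + pair_degree i p \in coboundaries D omega k.
Proof.
move=> /andP[pk /eqP wp]; have := dx_dy_omega i pk.
rewrite wp !linear0 => /esym/eqP; rewrite addr_eq0 => /eqP pE.
have low j : p \in divpow_deg j -> (j < 2)%N -> dx i (dy i p) = 0.
  case: j => [|[|//]] pj _; first by rewrite /dy contract_deg0 // linear0.
  by rewrite /dx contract_deg0 // contract_deg.
case: k pk => [|[|k]] pk; try by rewrite pE (low _ pk) // mulr0 oppr0 rpred0.
apply/asboolP; exists (- dx i (dy i p)); last by rewrite mulrN.
by rewrite rpredN !contract_deg.
Qed.

Hypothesis K2 : 2%N \in [pchar K].

Let cobound_cocycle := @divpow_coboundaries_sub K V m x y.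

Lemma pair_degree_cocycle i k p :
  p \in cocycles D omega k -> pair_degree i p \in cocycles D omega k.
Proof.
move=> pZ; rewrite -(rpredDl _ pZ).
exact/cobound_cocycle/pair_degree_cohomologous.
Qed.

Let divpow_char2 : 2%N \in [pchar divpow V].
Proof. by rewrite inE /= -scaler_nat (pcharf0 K2) scale0r. Qed.

Let char2_subrDA (R : comNzRingType) (R2 : 2%N \in [pchar R]) (a b c : R) :
  a - c = (a + b) + (b - c).
Proof. by rewrite -{2}(oppr_pchar2 R2 b) addrA addrK. Qed.

Lemma iter_pair_degree_cohomologous s k p : p \in cocycles D omega k ->
  p - iter_pair_degree s p \in coboundaries D omega k.
Proof.
elim: s p => [|i s IHs] p pZ /=; first by rewrite subrr rpred0.
rewrite (char2_subrDA divpow_char2 p (pair_degree i p)).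
by rewrite rpredD ?IHs ?pair_degree_cocycle ?pair_degree_cohomologous.
Qed.

(** On cohomology the product of all E_i is both 1 and, for k < m, 0; their sum is
    both m and k. *)
Theorem cohomology_vanishing k : (k < m)%N \/ k <> m %[mod 2] ->
  {subset cocycles D omega k <= coboundaries D omega k}.
Proof.
move=> km p pZ; have pk : p \in divpow_deg k by case/andP: pZ.
case: km => [km|/eqP km].
  rewrite -[p]subr0 -(@iter_pair_degree_eq0 (enum 'I_m) k p) ?enum_uniq //.
    exact: iter_pair_degree_cohomologous.
  by rewrite size_enum_ord.
have : \sum_i (p + pair_degree i p) \in coboundaries D omega k.
  by rewrite rpred_sum // => i _; apply: pair_degree_cohomologous.
rewrite big_split /= sumr_const card_ord (sum_pair_degree pk) -mulrnDr.
rewrite (char2_mulrn_odd divpow_char2) //.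
by move: km; rewrite !modn2 oddD; case: odd; case: odd.
Qed.

End Symplectic.

(** * Monomials with odd exponents *)

Section Words.
Variables (K : fieldType) (V : vectType K) (I : eqType).
Variables (lam : I -> {scalar V}) (z : I -> V).
Hypothesis dual : forall i j, lam i (z j) = (i == j)%:R.
Variables (A : comAlgType K) (g : V -> nat -> A).
Hypothesis gP : dp_system g.

Let T := dp_taylor lam g.

Lemma sh_deriv_prod_taylor i (c : I -> nat) s : i \notin s ->
  sh_deriv i (\prod_(j <- s) T (z j) (c j)) = 0.
Proof.
elim: s => [|j s IHs]; first by rewrite big_nil sh_deriv1.
rewrite inE negb_or big_cons => /andP[/negPf ij /IHs sE].
rewrite sh_derivM sE mulr0 addr0 /T.
case: (c j) => [|a]; first by rewrite dp_taylor0 // sh_deriv1 mul0r.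
by rewrite sh_deriv_taylor dual ij scale0r mul0r.
Qed.

(** Reading off the letters of the word one by one lowers the exponents one by one:
    the derivative at i only sees the factor of z_i. *)
Lemma sh_coef_prod_taylor (c : I -> nat) s : uniq s ->
  sh_coef (flatten [seq nseq (c i) i | i <- s]) (\prod_(i <- s) T (z i) (c i)) = 1.
Proof.
elim: s => [|i s IHs] /=; first by rewrite big_nil sh_coef1.
case/andP=> is_ us; rewrite big_cons -{}[RHS](IHs us).
have := sh_deriv_prod_taylor c is_; move: (\prod_(j <- s) _) => Q DQ.
elim: (c i) => [|a IHa]; first by rewrite /T dp_taylor0 // mul1r.
rewrite /= sh_coef_cons sh_derivM DQ mulr0 addr0 sh_deriv_taylor dual eqxx.
by rewrite scale1r.
Qed.

End Words.

Section OddMonomial.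
Variables (K : fieldType) (V : vectType K).
Variable f : {bilinear V -> V -> K | *%R & *%R}.
Variables (m : nat) (x y : 'I_m -> V).
Hypothesis xy_basis : symplectic_basis f x y.
Hypothesis K2 : 2%N \in [pchar K].

Local Notation omega := (dp_omega x y).
Local Notation D := (fun j => divpow_deg j : submodClosed (divpow V)).

Definition x_monomial (c : 'I_m -> nat) : divpow V := \prod_i dp (x i) (c i).

Lemma x_monomial_deg c : x_monomial c \in divpow_deg (\sum_i c i)%N.
Proof.
apply: lspan_gen; exists [seq (x i, c i) | i <- index_enum 'I_m].
  by rewrite -map_comp sumnE big_map.
by rewrite big_map.
Qed.

(** Each term of omega brings a factor x_i x_i^(c) = (c + 1) x_i^(c+1) = 0. *)
Lemma x_monomial_cocycle c : (forall i, odd (c i)) ->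
  x_monomial c \in cocycles D omega (\sum_i c i)%N.
Proof.
move=> c_odd; rewrite unfold_in x_monomial_deg /= mulr_suml big1 // => i _.
rewrite /x_monomial (bigD1 i) //=; apply: mulrACA_eq0.
rewrite dpM bin1 -scaler_nat natrD.
by rewrite (char2_mulrn_odd K2 _ (c_odd i)) -(natrD _ 1 1) (pcharf0 K2) scale0r.
Qed.

(** The letter i is the coordinate of x_i, so every y_j is sent to 0. *)
Let kill_y : divpow V -> shuffle_alg 'I_m K^o :=
  dp_lift (dp_system_taylor (fun i => applyr f (y i)) (dp_system_aug V K^o)).

Let kill_y_omega : kill_y omega = 0.
Proof.
rewrite /kill_y linear_sum big1 // => i _; rewrite rmorphM /= !dp_lift_dp.
rewrite [X in _ * X](_ : _ = 0) ?mulr0 //; apply: sh_coefP => -[|j w].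
  by rewrite dp_taylor_nil.
rewrite sh_coef_cons sh_deriv_taylor /=.
by have [_ _ ->] := xy_basis.2 i j; rewrite scale0r.
Qed.

Lemma x_monomial_neq_omegaM c p : x_monomial c <> omega * p.
Proof.
move=> /(congr1 kill_y).
rewrite {2}/kill_y rmorphM /= -/(kill_y omega) kill_y_omega mul0r.
rewrite /kill_y rmorph_prod /=; under eq_bigr => i _ do rewrite dp_lift_dp.
have dual i j : applyr f (y i) (x j) = (i == j)%:R.
  by have [/= -> _ _] := xy_basis.2 j i; rewrite eq_sym.
have := sh_coef_prod_taylor dual (dp_system_aug V K^o) c (index_enum_uniq _).
by move=> + E0; rewrite E0 linear0 => /esym/eqP; rewrite oner_eq0.
Qed.

Lemma x_monomial_not_coboundary c k :
  x_monomial c \notin coboundaries D omega k.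
Proof.
case: k => [|[|k]]; apply/negP.
- by move=> /eqP cE; apply: (@x_monomial_neq_omegaM c 0); rewrite mulr0.
- by move=> /eqP cE; apply: (@x_monomial_neq_omegaM c 0); rewrite mulr0.
- by move=> /asboolP[p _] /x_monomial_neq_omegaM.
Qed.

End OddMonomial.

(** * Vanishing and non-vanishing of the cohomology *)

Lemma cohomology_eq0P (K : fieldType) (A : comAlgType K)
    (D : nat -> submodClosed A) (w : A) (k : nat) :
  (forall h : cohomology D w k, h = 0) <->
  {subset cocycles D w k <= coboundaries D w k}.
Proof.
pose S := @coboundary K A D w k.
have pi_eq0 z : (generic_quotient.pi (Quotient.quot S) z == 0) = (z \in S).
  by rewrite -[0](raddf0 (generic_quotient.pi (Quotient.quot S)))
    -Quotient.idealrBE subr0.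
split=> [H0 p pZ|sub h].
  have := pi_eq0 (exist _ p pZ); rewrite [X in X == 0]H0 eqxx => /esym.
  by [].
rewrite -(generic_quotient.reprK h); apply/eqP; rewrite pi_eq0.
exact/sub/valP.
Qed.

Theorem corollary2p3 (K : fieldType) (charK : 2%N \in [pchar K])
    (m : nat) (m_gt0 : (1 <= m)%N)
    (V : vectType K) (dimV : \dim {:V} = (2 * m)%N)
    (f : {bilinear V -> V -> K | *%R & *%R})
    (f_alternating : forall v, f v v = 0)
    (f_nondegenerate : nondegenerate_form f)
    (x y : 'I_m -> V) (xy_basis : symplectic_basis f x y)
    (k : nat) :
  (forall h : divpow_cohomology x y k, h = 0) <->
  (k < m)%N \/ k <> m %[mod 2].
Proof.
rewrite cohomology_eq0P; split; last exact: cohomology_vanishing xy_basis charK k.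
move=> sub; case: (ltnP k m) => [km|mk]; [by left | right => km].
(* The exponents 1 add up to m; the even excess k - m goes to the first one. *)
pose i0 := Ordinal m_gt0.
pose c i := if i == i0 then (k - m).+1 else 1%N.
have c_odd i : odd (c i).
  rewrite /c; case: eqP => // _; rewrite /= oddB //.
  by move: km; rewrite !modn2; case: odd; case: odd.
have sum_c : (\sum_i c i)%N = k.
  rewrite (bigD1 i0) //= {1}/c eqxx (eq_bigr (fun=> 1%N)) => [|i /negPf ii0].
    by rewrite sum1_card cardC1 card_ord addSnnS prednK // subnK.
  by rewrite /c ii0.
have := x_monomial_cocycle x y charK c_odd; rewrite sum_c.
by move=> /sub; apply/negP/(x_monomial_not_coboundary xy_basis).
Qed.
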